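(* Let $X=(x_{ij})$ be an $n\times n$ alternating matrix of indeterminates over $\mathbb{Z}$, with $n\geqslant4$ even. Set $S=\mathbb{Z}[X]$ and $R=S/(\operatorname{pf}X)$. Fix a prime $p>0$ and let $\varphi_p$ be the standard $p$-derivation on $S$ with respect to the indeterminates $x_{ij}$, $i<j$. Then \[ \left[\frac{\varphi_p(\operatorname{pf}X)}{(x_{12}\cdots x_{1n})^p}\right]\in H^{n-1}_{(x_{12},\dots,x_{1n})}(R) \] is a nonzero $p$-torsion element, and its image in $H^{n-1}_{(x_{12},\dots,x_{1n})}(R/pR)$ is nonzero. In particular, $H^{n-1}_{(x_{12},\dots,x_{1n})}(R)$ contains a nonzero $p$-torsion element for each prime $p>0$.
   Context: $\operatorname{pf}X$ is the Pfaffian of $X$. For a polynomial ring $S=\mathbb{Z}[\boldsymbol{x}]$, the standard lift of Frobenius $\Lambda_p$ is the ring endomorphism with $\Lambda_p(x)=x^p$ for each indeterminate $x$, and the standard $p$-derivation is $\varphi_p(s)=(\Lambda_p(s)-s^p)/p$. The local cohomology class is the Čech class of the image of $\varphi_p(\operatorname{pf}X)$ in $R$. *)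

(* Defs.v *)
From HB Require Import structures.
From mathcomp Require Import all_boot all_order all_algebra all_fingroup.
From mathcomp Require Import mpoly.
Set Implicit Arguments. Unset Strict Implicit. Unset Printing Implicit Defensive.
Import GRing.Theory.
Local Open Scope ring_scope.

(* Indeterminates x_ij, i < j (0-indexed), of an n x n alternating matrix. *)
Definition pairT (n : nat) := {ij : 'I_n * 'I_n | (ij.1 < ij.2)%N}.
Definition nv (n : nat) : nat := #|{: pairT n}|.

Definition Spoly (n : nat) := {mpoly int[nv n]}.

Definition xvar (n : nat) (i j : 'I_n) : Spoly n :=
  match @insub _ (fun ij : 'I_n * 'I_n => (ij.1 < ij.2)%N) (pairT n) (i, j) with
  | Some q => 'X_(enum_rank q)
  | None => 0
  end.

Definition altX (n : nat) (i j : 'I_n) : Spoly n :=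
  if (i < j)%N then xvar i j else if (j < i)%N then - xvar j i else 0.

Definition altXn (n : nat) (a b : nat) : Spoly n :=
  match @insub _ (fun k => (k < n)%N) 'I_n a, @insub _ (fun k => (k < n)%N) 'I_n b with
  | Some i, Some j => altX i j
  | _, _ => 0
  end.

Definition permn (n : nat) (s : 'S_n) (a : nat) : nat :=
  match @insub _ (fun k => (k < n)%N) 'I_n a with
  | Some i => val (s i)
  | None => 0%N
  end.

Definition pfaff_perm (n : nat) (s : 'S_n) : bool :=
  [forall k : 'I_(n./2), (permn s k.*2 < permn s k.*2.+1)%N] &&
  [forall k : 'I_(n./2), (k.+1 < n./2)%N ==> (permn s k.*2 < permn s k.+1.*2)%N].

Definition pf (n : nat) : Spoly n :=
  \sum_(s : 'S_n | pfaff_perm s)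
     (-1) ^+ s * \prod_(k < n./2) altXn n (permn s k.*2) (permn s k.*2.+1).

(* standard lift of Frobenius: x |-> x^p for each indeterminate *)
Definition Lambda (n p : nat) (f : Spoly n) : Spoly n :=
  f \mPo [tuple ('X_i : Spoly n) ^+ p | i < nv n].

(* standard p-derivation: (Lambda_p f - f^p) / p  (exact division, coefficientwise) *)
Definition phi (n p : nat) (f : Spoly n) : Spoly n :=
  map_mpoly (fun c : int => (c %/ (p%:Z))%Z) (Lambda p f - f ^+ p).

Definition in_ideal (n : nat) (gs : seq (Spoly n)) (f : Spoly n) : Prop :=
  exists c : seq (Spoly n), f = \sum_(i < size gs) c`_i * gs`_i.

(* The Cech class [r / (g_1 ... g_d)^e] in the top local cohomology
   H^d_{(g_1..g_d)}(S/(rel)) is zero iff for some t,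
   r (g_1...g_d)^t lies in (rel) + (g_1^(e+t), ..., g_d^(e+t)). *)
Definition cech_top_class_zero (n : nat) (rel gens : seq (Spoly n))
    (r : Spoly n) (e : nat) : Prop :=
  exists t : nat,
    in_ideal (rel ++ [seq g ^+ (e + t) | g <- gens])
             (r * (\prod_(g <- gens) g) ^+ t).

(* the first-row indeterminates x_12, ..., x_1n (1-indexed) *)
Definition firstrow (n : nat) : seq (Spoly n) :=
  [seq altXn n 0 j | j <- iota 1 n.-1].

(* Main.v *)
(** Every term of the Pfaffian contains a first-row indeterminate, so [Lambda p (pf n)]
    lies in the ideal of their p-th powers; as [p * phi p f = Lambda p f - f ^+ p], this
    gives the p-torsion.  For nonvanishing, specialize X so that pf X becomes
    x_01 x_23 - x_02 x_13 + x_03 x_12 while the first row stays free, and then set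
    x_23 = d u_2 u_3, x_13 = B d u_1 u_3, x_12 = (B - 1) d u_1 u_2 with u_j = x_0j, which
    kills pf X.  On the specialized ring consider the coefficient of
    B d^p (u_1 u_2 u_3)^(p+t) (u_4 ... u_(n-1))^t.  It is divisible by p on multiples of
    u_j^(p+t), because there the only available coefficients are constants and multiples
    of B^p or of (B - 1)^p.  On [Lambda p (pf n)] times (u_1 ... u_(n-1))^t it is the
    B-coefficient of 1 - B^p + (B - 1)^p, that is p up to sign; hence it is a unit on
    [phi p (pf n)] times that power. *)

Require Import Defs.
From HB Require Import structures.
From mathcomp Require Import all_boot all_order all_algebra all_fingroup.
From mathcomp Require Import mpoly zify.
Set Implicit Arguments. Unset Strict Implicit. Unset Printing Implicit Defensive.
Import GRing.Theory.

(** * Permutations as functions on natural numbers, and the matchings they encode *)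

Lemma permnE (n : nat) (s : 'S_n) (a : nat) (lt_an : (a < n)) :
  permn s a = s (Ordinal lt_an).
Proof. by rewrite /permn insubT. Qed.

Lemma permn_lt (n : nat) (s : 'S_n) (a : nat) : (a < n) -> (permn s a < n).
Proof. by move=> lt_an; rewrite permnE ltn_ord. Qed.

Lemma permn_inj (n : nat) (s : 'S_n) (a b : nat) :
  (a < n) -> (b < n) -> permn s a = permn s b -> a = b.
Proof. by move=> la lb; rewrite !permnE => /val_inj/perm_inj[]. Qed.

Lemma eq_permn (n : nat) (s t : 'S_n) :
  (forall a, (a < n) -> permn s a = permn t a) -> s = t.
Proof.
move=> st; apply/permP => -[a la]; apply: val_inj.
by have := st a la; rewrite !permnE.
Qed.

Lemma permn1 (n a : nat) : (a < n) -> permn (1%g : 'S_n) a = a.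
Proof. by move=> la; rewrite permnE perm1. Qed.

Lemma permnM (n : nat) (s t : 'S_n) (a : nat) :
  (a < n) -> permn (s * t)%g a = permn t (permn s a).
Proof.
move=> la; rewrite (permnE s la) (permnE _ la) permM (permnE t (ltn_ord _)).
by congr (val (t _)); apply: val_inj.
Qed.

Lemma permn_tperm (n : nat) (i j : 'I_n) (a : nat) : (a < n) ->
  permn (tperm i j) a = if a == i then val j else if a == j then val i else a.
Proof.
move=> la; rewrite permnE; case: tpermP => [<-|<-|] /=.
- by rewrite eqxx.
- by case: eqP => [->|_] //; rewrite eqxx.
by move=> /eqP + /eqP; rewrite -!val_eqE /= => /negbTE-> /negbTE->.
Qed.

Lemma pfaff_permP (n : nat) (s : 'S_n) :
  reflect ((forall k, (k < n./2) -> (permn s k.*2 < permn s k.*2.+1)) /\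
           (forall k, (k.+1 < n./2) -> (permn s k.*2 < permn s k.+1.*2)))
          (pfaff_perm s).
Proof.
apply: (iffP andP) => -[h1 h2]; split.
- by move=> k lk; apply: (forallP h1 (Ordinal lk)).
- move=> k lk; have lk' : (k < n./2) by lia.
  by apply: (implyP (forallP h2 (Ordinal lk'))).
- by apply/forallP => k; apply: h1.
- by apply/forallP => k; apply/implyP => lk; apply: h2.
Qed.

(** The left ends of the pairs increase and each lies below its right end, so the least value cannot
    occur later than position 0. *)
Lemma pfaff_perm_permn0 (n : nat) (s : 'S_n) :
  (0 < n) -> ~~ odd n -> pfaff_perm s -> permn s 0 = 0.
Proof.
move=> n0 en /pfaff_permP[h1 h2].
have ge0 k : (k < n./2) -> (permn s 0 <= permn s k.*2).
  by elim: k => [//|k IH] lk; have := h2 k lk; have := IH (ltnW lk); lia.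
pose i := (s^-1)%g (Ordinal n0).
have vi : permn s i = 0.
  rewrite (permnE s (ltn_ord i)) [Ordinal _](_ : _ = i); last exact: val_inj.
  by rewrite /i permKV.
have li : (i./2 < n./2) by have := ltn_ord i; lia.
move: vi (ge0 _ li) (h1 _ li); rewrite -{1}(odd_double_half i).
by case: (odd i); rewrite ?add1n ?add0n; lia.
Qed.

(* With only these entries nonzero, a perfect matching restricts to one of the
   three matchings of {0, 1, 2, 3}: a vertex above 3 is joined only to 0 and to
   its partner, and joining it to 0 would leave that partner unmatched. *)
Definition sparse_edge (a b : nat) : bool :=
  [|| a == 0, (a == 1) && (b == 2), (a == 1) && (b == 3), (a == 2) && (b == 3)
    | [&& 3 < a, ~~ odd a & b == a.+1]].

Lemma sparse_matchings (n : nat) (s : 'S_n) :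
  (4 <= n) -> ~~ odd n -> pfaff_perm s ->
  (forall k, (k < n./2) -> sparse_edge (permn s k.*2) (permn s k.*2.+1)) ->
  [/\ permn s 0 = 0,
      forall a, (4 <= a < n) -> permn s a = a
    & [\/ [/\ permn s 1 = 1, permn s 2 = 2 & permn s 3 = 3],
          [/\ permn s 1 = 2, permn s 2 = 1 & permn s 3 = 3]
        | [/\ permn s 1 = 3, permn s 2 = 1 & permn s 3 = 2]]].
Proof.
move=> n4 en ps hE; have v0 := pfaff_perm_permn0 (ltn_trans (isT : 0 < 3) n4) en ps.
have [h1 h2] := pfaff_permP _ ps.
have inj := @permn_inj _ s; have ltv := @permn_lt _ s.
move: (permn s) v0 h1 h2 hE inj ltv => v v0 h1 h2 hE inj ltv.
have E1 : sparse_edge (v 2) (v 3) by apply: (hE 1); lia.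
have L1 : v 0 < v 2 by apply: (h2 0); lia.
rewrite /sparse_edge in E1.
(* In the base case, two disjoint edges cannot both lie in {1, 2, 3}. Later left ends exceed 3,
   hence are even, so each strict increase is by at least 2. *)
have lo k : (k.+2 < n./2) -> (k.+2.*2 <= v k.+2.*2).
  elim: k => [|k IH] lk.
    have E2 : sparse_edge (v 4) (v 5) by apply: (hE 2); lia.
    have L2 : v 2 < v 4 by apply: (h2 1); lia.
    have i24 : v 2 <> v 4 by move/inj; lia.
    have i25 : v 2 <> v 5 by move/inj; lia.
    have i34 : v 3 <> v 4 by move/inj; lia.
    have i35 : v 3 <> v 5 by move/inj; lia.
    by rewrite /sparse_edge in E2; rewrite -[0.+2.*2]/4; lia.
  have Ek := hE k.+3 lk; have Lk := h2 k.+2 lk; have := IH (ltnW lk).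
  by rewrite /sparse_edge in Ek; lia.
(* Downward induction from the last pair, with [j] counting the pairs after the current one. The
   last left end is below its right end, which is below [n]; evenness again turns each strict
   inequality into a gap of 2. *)
have up j k : (j + k.+3 = n./2) -> (v k.+2.*2 <= k.+2.*2).
  elim: j k => [|j IH] k ek.
    have lk : (k.+2 < n./2) by lia.
    have := h1 _ lk; have := ltv k.+2.*2.+1 ltac:(lia); lia.
  have lk : (k.+2 < n./2) by lia.
  have lk' : (k.+3 < n./2) by lia.
  have := IH k.+1 ltac:(lia); have := h2 _ lk'; have := hE _ lk; have := lo _ lk.
  have := hE _ lk'; have := lo _ lk'; rewrite /sparse_edge; lia.
have ev k : (k.+2 < n./2) -> v k.+2.*2 = k.+2.*2.
  by move=> lk; have := lo k lk; have := up (n./2 - k.+3) k ltac:(lia); lia.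
have od k : (k.+2 < n./2) -> v k.+2.*2.+1 = k.+2.*2.+1.
  by move=> lk; have := hE _ lk; rewrite (ev k lk) /sparse_edge; lia.
have big a : (4 <= a < n) -> v a = a.
  move=> la; have ea := odd_double_half a.
  have e2 : a./2 = (a./2 - 2).+2 by lia.
  have l2 : ((a./2 - 2).+2 < n./2) by lia.
  by move: ea; rewrite e2; case: (odd a) => /= <-; [exact: od | exact: ev].
split=> //.
have i01 : v 1 <> v 0 by move/inj; lia.
have i12 : v 1 <> v 2 by move/inj; lia.
have i13 : v 1 <> v 3 by move/inj; lia.
(* Values from 4 on are already taken by fixed points, so injectivity keeps the first four positions
   below 4. *)
have small a : a < 4 -> v a < 4.
  move=> a4; rewrite ltnNge; apply/negP => g.
  have la : a < n by lia.
  have := big (v a); rewrite g ltv // => /(_ isT) /inj.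
  by rewrite ltv // => /(_ isT la); lia.
have v1 := small 1 isT.
have /or3P[] : [|| (v 2 == 1) && (v 3 == 2), (v 2 == 1) && (v 3 == 3)
                 | (v 2 == 2) && (v 3 == 3)] by have := small 2 isT; lia.
- by case/andP=> /eqP e2 /eqP e3; constructor 3; split=> //; lia.
- by case/andP=> /eqP e2 /eqP e3; constructor 2; split=> //; lia.
- by case/andP=> /eqP e2 /eqP e3; constructor 1; split=> //; lia.
Qed.

Local Open Scope ring_scope.

(** * The Frobenius lift and the p-derivation *)

Lemma mpoly_int_rmorph_ext (N : nat) (T : comNzRingType)
    (f g : {rmorphism {mpoly int[N]} -> T}) :
  (forall i, f 'X_i = g 'X_i) -> f =1 g.
Proof.
move=> fgX q; rewrite (mpolyE q) !rmorph_sum; apply: eq_bigr => mu _ /=.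
rewrite -mul_mpolyC !rmorphM; congr (_ * _).
  by rewrite -[q@_mu]intz /= !rmorph_int.
rewrite mpolyXE_id !rmorph_prod; apply: eq_bigr => i _ /=.
by rewrite !rmorphXn fgX.
Qed.

Lemma Lambda_is_zmod_morphism (n p : nat) : zmod_morphism (@Lambda n p).
Proof. by move=> x y; rewrite /Lambda raddfB. Qed.
Lemma Lambda_is_monoid_morphism (n p : nat) : monoid_morphism (@Lambda n p).
Proof. by split=> [|x y]; rewrite /Lambda ?rmorph1 ?rmorphM. Qed.

HB.instance Definition _ n p :=
  GRing.isZmodMorphism.Build (Spoly n) (Spoly n) (@Lambda n p) (@Lambda_is_zmod_morphism n p).
HB.instance Definition _ n p :=
  GRing.isMonoidMorphism.Build (Spoly n) (Spoly n) (@Lambda n p) (@Lambda_is_monoid_morphism n p).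

Lemma LambdaX (n p : nat) (i : 'I_(nv n)) : Lambda p ('X_i : Spoly n) = 'X_i ^+ p.
Proof. by rewrite /Lambda comp_mpolyXU -tnth_nth tnth_mktuple. Qed.

(* Reduced mod p, both [Lambda] and the p-th power are ring morphisms. *)
Lemma dvdp_Lambda_sub_exp (n p : nat) (f : Spoly n) (mu : 'X_{1..nv n}) :
  prime p -> (p%:Z %| (Lambda p f - f ^+ p)@_mu)%Z.
Proof.
move=> pp; have cF := pchar_Fp pp.
have cM : p \in [pchar {mpoly 'F_p[nv n]}] by rewrite pchar_lalg.
rewrite (dvdz_pcharf cF).
pose r := map_mpoly (intmul 1 : int -> 'F_p) : {mpoly int[nv n]} -> {mpoly 'F_p[nv n]}.
have rE : r (Lambda p f) = pFrobenius_aut cM (r f).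
  apply: (@mpoly_int_rmorph_ext _ _ (r \o Lambda p) (pFrobenius_aut cM \o r)) => i.
  by rewrite /= LambdaX rmorphXn /= pFrobenius_autE.
have rB : r (Lambda p f - f ^+ p) = 0.
  by rewrite {1}/r rmorphB /= -/r rE pFrobenius_autE /r rmorphXn subrr.
by rewrite -mcoeff_map_mpoly /= -/r rB mcoeff0.
Qed.

(** Every coefficient is divisible by [p], so the coefficientwise integer quotient in [phi] is
    exact. *)
Lemma mulr_phi (n p : nat) (f : Spoly n) :
  prime p -> p%:R * phi p f = Lambda p f - f ^+ p.
Proof.
move=> pp; rewrite /phi; set q := Lambda p f - f ^+ p.
rewrite /map_mpoly /mmap mulr_sumr [RHS](mpolyE q); apply: eq_bigr => mu _ /=.
rewrite mmap1_id mulrA -[p%:R](rmorph_nat (@mpolyC (nv n) int)) -rmorphM mul_mpolyC.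
by rewrite /= mulrC natz divzK // dvdp_Lambda_sub_exp.
Qed.

(** * Membership in ideals given by generators *)

(** A test for non-membership. Additivity of [F] is enough, without linearity over the polynomial
    ring, because all multiples of each generator are tested. *)
Lemma in_ideal_raddf_dvd (n : nat) (d : int) (F : {additive Spoly n -> int})
    (gs : seq (Spoly n)) (r : Spoly n) :
  (forall g c, g \in gs -> (d %| F (c * g))%Z) -> in_ideal gs r -> (d %| F r)%Z.
Proof.
move=> hF [c ->]; rewrite raddf_sum; apply: (big_ind (fun x => (d %| x)%Z)) => //=.
  by move=> x y; apply: rpredD.
by move=> i _; apply: hF; rewrite mem_nth.
Qed.

Lemma in_idealD (n : nat) (gs : seq (Spoly n)) (f g : Spoly n) :
  in_ideal gs f -> in_ideal gs g -> in_ideal gs (f + g).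
Proof.
move=> [c ->] [d ->]; exists (mkseq (fun i => c`_i + d`_i) (size gs)).
by rewrite -big_split; apply: eq_bigr => i _ /=; rewrite nth_mkseq // mulrDl.
Qed.

Lemma in_ideal0 (n : nat) (gs : seq (Spoly n)) : in_ideal gs 0.
Proof. by exists [::]; rewrite big1 // => i _; rewrite nth_nil mul0r. Qed.

Lemma in_idealM (n : nat) (gs : seq (Spoly n)) (c g : Spoly n) :
  g \in gs -> in_ideal gs (c * g).
Proof.
move=> gin; have lt := gin; rewrite -index_mem in lt.
exists (mkseq (fun i => if i == index g gs then c else 0) (size gs)).
rewrite (bigD1 (Ordinal lt)) //= nth_mkseq // eqxx nth_index // big1 ?addr0 //.
by move=> i; rewrite -val_eqE /= => /negbTE ne; rewrite nth_mkseq // ne mul0r.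
Qed.

(** * Images of the Pfaffian under ring morphisms *)

Definition row_ix (n : nat) (i : 'I_(nv n)) : nat := (val (enum_val i)).1.
Definition col_ix (n : nat) (i : 'I_(nv n)) : nat := (val (enum_val i)).2.

Lemma altXnE (n a b : nat) : (a < b < n)%N ->
  exists2 i : 'I_(nv n), altXn n a b = 'X_i
    & row_ix i = a /\ col_ix i = b.
Proof.
case/andP=> lab lbn; have lan := ltn_trans lab lbn.
exists (enum_rank (Sub (Ordinal lan, Ordinal lbn) lab : pairT n)).
  by rewrite /altXn !insubT /altX /= lab /xvar insubT.
by rewrite /row_ix /col_ix enum_rankK.
Qed.

Lemma Lambda_altXn (n p a b : nat) :
  (a < b < n)%N -> Lambda p (altXn n a b) = altXn n a b ^+ p.
Proof. by case/altXnE=> i -> _; rewrite LambdaX. Qed.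

(** Each pair of a Pfaffian permutation is increasing, so only entries above the diagonal occur and
    [w] is compared with [f] only there. This serves [Lambda], the specialization and their
    composite alike. *)
Lemma rmorph_pf (n : nat) (T : comNzRingType) (f : {rmorphism Spoly n -> T})
    (w : nat -> nat -> T) :
  ~~ odd n -> (forall a b, (a < b < n)%N -> f (altXn n a b) = w a b) ->
  f (pf n) = \sum_(s : 'S_n | pfaff_perm s)
     (-1) ^+ s * \prod_(k < n./2) w (permn s k.*2) (permn s k.*2.+1).
Proof.
move=> en fw; rewrite /pf rmorph_sum; apply: eq_bigr => s ps /=.
rewrite rmorphM rmorph_sign rmorph_prod; congr (_ * _); apply: eq_bigr => k _ /=.
have [h1 _] := pfaff_permP _ ps.
by rewrite fw // h1 // permn_lt //; have := ltn_ord k; lia.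
Qed.

Lemma sparse_pf_sum (n : nat) (T : comNzRingType) (w : nat -> nat -> T) :
  (4 <= n)%N -> ~~ odd n ->
  (forall a b, ~~ sparse_edge a b -> w a b = 0) ->
  (forall a, (4 <= a)%N -> ~~ odd a -> w a a.+1 = 1) ->
  \sum_(s : 'S_n | pfaff_perm s)
     (-1) ^+ s * \prod_(k < n./2) w (permn s k.*2) (permn s k.*2.+1)
  = w 0%N 1%N * w 2%N 3%N - w 0%N 2%N * w 1%N 3%N + w 0%N 3%N * w 1%N 2%N.
Proof.
move=> n4 en w0 w1.
pose o1 : 'I_n := Ordinal (ltn_trans (isT : 1 < 3)%N n4).
pose o2 : 'I_n := Ordinal (ltn_trans (isT : 2 < 3)%N n4).
pose o3 : 'I_n := Ordinal n4.
(* These give the matchings starting {02, 13} and {03, 12}; a transposition and a 3-cycle, they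
   carry the signs - and +. *)
pose s2 : 'S_n := tperm o1 o2; pose s3 : 'S_n := (tperm o1 o3 * tperm o1 o2)%g.
(* The default [a] of [nth] expresses that every index from 4 on is fixed. *)
have v2 a : (a < n)%N -> permn s2 a = nth a [:: 0; 2; 1; 3]%N a.
  by move=> la; rewrite permn_tperm //; move: a la => [|[|[|[|a]]]] la //=; rewrite nth_nil.
have v3 a : (a < n)%N -> permn s3 a = nth a [:: 0; 3; 1; 2]%N a.
  move=> la; rewrite permnM // (permn_tperm o1 o2) ?permn_lt // permn_tperm //.
  by move: a la => [|[|[|[|a]]]] la //=; rewrite nth_nil.
have v1 a : (a < n)%N -> permn (1%g : 'S_n) a = nth a [:: 0; 1; 2; 3]%N a.
  by move=> la; rewrite permn1 //; move: a la => [|[|[|[|a]]]] la //=; rewrite nth_nil.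
have fam (s : 'S_n) (x y z : nat) :
    (forall a, (a < n)%N -> permn s a = nth a [:: 0; x; y; z]%N a) ->
    (0 < x)%N -> (y < z)%N -> (0 < y)%N -> (y < 4)%N ->
    pfaff_perm s /\ \prod_(k < n./2) w (permn s k.*2) (permn s k.*2.+1) = w 0%N x * w y z.
  move=> vs x0 yz y0 y4; split.
    apply/pfaff_permP; split=> -[|[|k]] lk; rewrite !vs ?doubleS //= ?nth_nil; lia.
  have -> : \prod_(k < n./2) w (permn s k.*2) (permn s k.*2.+1) =
            \prod_(k < n./2) if k == 0%N :> nat then w 0%N x else
                            if k == 1%N :> nat then w y z else 1.
    apply: eq_bigr => -[[|[|k]] lk] _ /=; rewrite !vs ?doubleS //= ?nth_nil; try lia.
    by rewrite w1 //= odd_double.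
  have -> : n./2 = (n./2 - 2).+2 by lia.
  by rewrite !big_ord_recl /= big1 ?mulr1.
have [p1 e1] := fam 1%g 1%N 2%N 3%N v1 isT isT isT isT.
have [p2 e2] := fam s2 2%N 1%N 3%N v2 isT isT isT isT.
have [p3 e3] := fam s3 3%N 1%N 2%N v3 isT isT isT isT.
have l1 : (1 < n)%N by lia.
have n21 : s2 != 1%g.
  by apply/eqP => /(congr1 (fun s => permn s 1)); rewrite v2 // v1.
have n31 : s3 != 1%g.
  by apply/eqP => /(congr1 (fun s => permn s 1)); rewrite v3 // v1.
have n32 : s3 != s2.
  by apply/eqP => /(congr1 (fun s => permn s 1)); rewrite v2 // v3.
rewrite (bigD1 1%g) //= (bigD1 s2) ?p2 //= (bigD1 s3) ?p3 ?n31 //=.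
rewrite e1 e2 e3 odd_perm1 odd_permM !odd_tperm /= big1 => [|s].
  by rewrite expr0 expr1 !mul1r mulN1r addr0 addrA.
move=> /andP[/andP[/andP[ps ns1] ns2] ns3].
have [hE|] := boolP [forall k : 'I_(n./2), sparse_edge (permn s k.*2) (permn s k.*2.+1)]; last first.
  by case/forallPn=> k nk; rewrite (bigD1 k) //= w0 // mul0r mulr0.
have [] := sparse_matchings n4 en ps.
  by move=> k lk; apply: (forallP hE (Ordinal lk)).
move=> a0 a4 cases.
have eqs (t : 'S_n) (x y z : nat) : 
    (forall a, (a < n)%N -> permn t a = nth a [:: 0; x; y; z]%N a) ->
    permn s 1 = x -> permn s 2 = y -> permn s 3 = z -> s = t.
  move=> vt sx sy sz; apply: eq_permn => -[|[|[|[|a]]]] la; rewrite vt //=.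
  by rewrite nth_nil a4.
case: cases => -[x y z].
- by rewrite (eqs _ _ _ _ v1 x y z) eqxx in ns1.
- by rewrite (eqs _ _ _ _ v2 x y z) eqxx in ns2.
- by rewrite (eqs _ _ _ _ v3 x y z) eqxx in ns3.
Qed.

(** * The specialization that kills the Pfaffian *)

(* The polynomial indeterminate is the header's B; of the [n] multivariate ones,
   the 0-th is the degree tracker d and the j-th is u_j = x_0j. *)
Definition sparse_coef (a b : nat) : {poly int} :=
  if (a == 1%N) && (b == 3%N) then 'X
  else if (a == 1%N) && (b == 2%N) then 'X - 1
  else (sparse_edge a b)%:R.

(** The three inner edges (a, b) get the exponents of d u_a u_b. Blocks above 3 get exponent zero,
    so that their entries become 1. *)
Definition sparse_exp (a b i : nat) : nat :=
  (if a == 0 then i == b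
   else if (a == 1) && (b == 2) then i < 3
   else if (a == 1) && (b == 3) then (i < 4) && (i != 2)
   else if (a == 2) && (b == 3) then (i < 4) && (i != 1)
   else false)%N.

Definition sparse_entry (n a b : nat) : {mpoly {poly int}[n]} :=
  sparse_coef a b *: 'X_[[multinom sparse_exp a b i | i < n]].

Definition sparse_entry_at (n : nat) (i : 'I_(nv n)) : {mpoly {poly int}[n]} :=
  sparse_entry n (row_ix i) (col_ix i).

Definition sparse_spec (n : nat) : Spoly n -> {mpoly {poly int}[n]} :=
  mmap intr (@sparse_entry_at n).

HB.instance Definition _ n := GRing.RMorphism.on (@sparse_spec n).

Lemma sparse_spec_altXn (n a b : nat) :
  (a < b < n)%N -> sparse_spec (altXn n a b) = sparse_entry n a b.
Proof.
case/altXnE => i -> [ea eb].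
by rewrite /sparse_spec mmapX mmap1U /sparse_entry_at ea eb.
Qed.

Lemma scale_mpolyXM (n : nat) (R : comNzRingType) (x y : R) (m1 m2 : 'X_{1..n}) :
  (x *: 'X_[m1]) * (y *: 'X_[m2]) = (x * y) *: 'X_[R, m1 + m2].
Proof. by rewrite -scalerAl -scalerAr scalerA mpolyXD. Qed.

Lemma prod_mpolyX (n : nat) (R : comNzRingType) (I : Type) (r : seq I) (F : I -> 'X_{1..n}) :
  \prod_(i <- r) 'X_[R, F i] = 'X_[\sum_(i <- r) F i].
Proof. by rewrite (big_morph _ (@mpolyXD n R) (@mpolyX0 n R)). Qed.

Lemma sparse_entry_nonedge (n a b : nat) :
  ~~ sparse_edge a b -> sparse_entry n a b = 0.
Proof.
rewrite /sparse_entry /sparse_coef => ne.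
have -> : (a == 1%N) && (b == 3%N) = false by move: ne; rewrite /sparse_edge; lia.
have -> : (a == 1%N) && (b == 2%N) = false by move: ne; rewrite /sparse_edge; lia.
by rewrite (negbTE ne) scale0r.
Qed.

Lemma sparse_entry_block (n a : nat) :
  (4 <= a)%N -> ~~ odd a -> sparse_entry n a a.+1 = 1.
Proof.
move=> a4 ea; rewrite /sparse_entry /sparse_coef.
have -> : sparse_edge a a.+1 by rewrite /sparse_edge; lia.
have -> : (a == 1%N) = false by lia.
rewrite scale1r -mpolyX0; congr 'X_[_]; apply/mnmP => i.
rewrite mnmE mnm0E /sparse_exp.
by do !case: ifP; lia.
Qed.

(** All three matchings yield the same monomial d u_1 u_2 u_3, so the specialized Pfaffian reduces
    to its scalar factor 1 - B + (B - 1). *)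
Lemma sparse_entryM (n j a b : nat) : (4 <= n)%N ->
  (j, a, b) \in [:: (1, 2, 3); (2, 1, 3); (3, 1, 2)]%N ->
  sparse_entry n 0 j * sparse_entry n a b
  = sparse_coef a b *: 'X_[[multinom (i < 4)%N : nat | i < n]].
Proof.
move=> n4 jab; rewrite /sparse_entry scale_mpolyXM.
congr (_ *: 'X_[_]).
  by rewrite /sparse_coef /sparse_edge /= mul1r.
apply/mnmP => -[i li]; rewrite mnmDE !mnmE /= /sparse_exp.
move: jab; rewrite !inE => /or3P[] /eqP[-> -> ->] /=; lia.
Qed.

Lemma sparse_spec_pf (n : nat) : (4 <= n)%N -> ~~ odd n -> sparse_spec (pf n) = 0.
Proof.
move=> n4 en; rewrite (rmorph_pf en (@sparse_spec_altXn n)).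
rewrite (sparse_pf_sum n4 en (@sparse_entry_nonedge n) (@sparse_entry_block n)).
rewrite !sparse_entryM //.
by rewrite /sparse_coef /= -scalerBl -scalerDl -[1%:R]/1 addrA subrK subrr scale0r.
Qed.

Lemma sparse_spec_Lambda_pf (n p : nat) : (0 < p)%N -> (4 <= n)%N -> ~~ odd n ->
  sparse_spec (Lambda p (pf n)) =
  (1 - 'X ^+ p + ('X - 1) ^+ p) *: 'X_[[multinom (i < 4)%N : nat | i < n] *+ p].
Proof.
move=> p0 n4 en.
(* The composite sends each entry to the p-th power of its specialization, which has the same zeros
   and ones, so the three-term expansion applies again. *)
rewrite -[LHS]/((@sparse_spec n \o @Lambda n p) (pf n)).
rewrite (@rmorph_pf n _ _ (fun a b => sparse_entry n a b ^+ p)) //.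
  rewrite (@sparse_pf_sum n _ (fun a b => sparse_entry n a b ^+ p)) //.
  - rewrite -!exprMn !sparse_entryM // !exprZn mpolyXn /sparse_coef /=.
    by rewrite expr1n -scalerBl -scalerDl.
  - by move=> a b ne; rewrite sparse_entry_nonedge // expr0n (gtn_eqF p0).
  - by move=> a a4 ea; rewrite sparse_entry_block // expr1n.
by move=> a b lab; rewrite /= Lambda_altXn // rmorphXn /= sparse_spec_altXn.
Qed.

Lemma sparse_spec_firstrow (n : nat) :
  sparse_spec (\prod_(g <- firstrow n) g) = 'X_[[multinom (0 < i)%N : nat | i < n]].
Proof.
rewrite rmorph_prod /firstrow big_map.
have -> : \prod_(j <- iota 1 n.-1) sparse_spec (altXn n 0 j) =
    \prod_(j <- iota 1 n.-1) 'X_[[multinom ((i : nat) == j) : nat | i < n]].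
  apply: eq_big_seq => j; rewrite mem_iota => lj.
  by rewrite sparse_spec_altXn /sparse_entry /sparse_coef /sparse_exp /= ?scale1r //; lia.
rewrite prod_mpolyX; congr 'X_[_]; apply/mnmP => i; rewrite mnm_sumE mnmE.
under eq_bigr do rewrite mnmE eq_sym.
rewrite -big_mkcond /= sum1_count.
by rewrite (count_uniq_mem _ (iota_uniq _ _)) mem_iota; have := ltn_ord i; lia.
Qed.

Lemma sparse_spec_X (n : nat) (mu : 'X_{1..nv n}) :
  sparse_spec 'X_[mu] =
  (\prod_(i < nv n) sparse_coef (row_ix i) (col_ix i) ^+ mu i) *:
  'X_[[multinom (\sum_(i < nv n) sparse_exp (row_ix i) (col_ix i) k * mu i)%N
        | k < n]].
Proof.
rewrite /sparse_spec mmapX /mmap1 -mul_mpolyC rmorph_prod.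
have -> : [multinom (\sum_(i < nv n) sparse_exp (row_ix i) (col_ix i) k * mu i)%N
     | k < n] = (\sum_(i < nv n) [multinom sparse_exp (row_ix i) (col_ix i) k | k < n] *+ mu i)%MM.
  apply/mnmP => k; rewrite mnm_sumE mnmE.
  by apply: eq_bigr => i _; rewrite mulmnE mnmE.
rewrite -prod_mpolyX -big_split /=; apply: eq_bigr => i _.
by rewrite /sparse_entry_at /sparse_entry -mul_mpolyC exprMn rmorphXn mpolyXn.
Qed.

Lemma ix_inj (n : nat) (i j : 'I_(nv n)) :
  row_ix i = row_ix j -> col_ix i = col_ix j -> i = j.
Proof.
move=> er ec; apply: enum_val_inj; apply: val_inj.
move: er ec; rewrite /row_ix /col_ix.
by case: (val _) => a b; case: (val _) => c d /= /val_inj-> /val_inj->.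
Qed.

Lemma eq_ix (n : nat) (i j : 'I_(nv n)) :
  (i == j) = (row_ix i == row_ix j) && (col_ix i == col_ix j).
Proof.
by apply/eqP/andP => [-> | [/eqP er /eqP ec]]; [rewrite !eqxx | exact: ix_inj].
Qed.

Lemma ltn_ix (n : nat) (i : 'I_(nv n)) : (row_ix i < col_ix i)%N.
Proof. exact: (valP (enum_val i)). Qed.

(** * The coefficient functional and its divisibility *)

Lemma coef1_XsubC1_exp (p : nat) : (('X - 1 : {poly int}) ^+ p)`_1 = (-1) ^+ p.-1 *+ p.
Proof.
(* The linear coefficient is the constant term of the derivative. *)
have := coef_deriv (('X - 1 : {poly int}) ^+ p) 0; rewrite mulr1n => <-.
rewrite deriv_exp derivB derivX -[(1 : {poly int})^`()]/((1%:P)^`()) derivC subr0 mul1r.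
by rewrite coefMn -horner_coef0 horner_exp !hornerE.
Qed.

Definition sparse_target (n p t : nat) : 'X_{1..n} :=
  [multinom (if (i : nat) == 0 then p else if i < 4 then p + t else t)%N | i < n].

Definition sparse_functional (n p t : nat) : Spoly n -> int :=
  coefp 1 \o mcoeff (sparse_target n p t) \o @sparse_spec n.

HB.instance Definition _ n p t := GRing.Additive.on (@sparse_functional n p t).

Lemma sparse_functional_Lambda_pf (n p t : nat) :
  (1 < p)%N -> (4 <= n)%N -> ~~ odd n ->
  sparse_functional p t (Lambda p (pf n) * (\prod_(g <- firstrow n) g) ^+ t)
  = (-1) ^+ p.-1 *+ p.
Proof.
move=> p1 n4 en; rewrite /sparse_functional /= rmorphM rmorphXn /=.
rewrite sparse_spec_Lambda_pf ?(ltnW p1) // sparse_spec_firstrow mpolyXn.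
rewrite -scalerAl -mpolyXD mcoeffZ mcoeffX.
have -> : ([multinom (i < 4)%N : nat | i < n] *+ p
           + [multinom (0 < i)%N : nat | i < n] *+ t)%MM = sparse_target n p t.
  apply/mnmP => -[i li]; rewrite mnmDE !mulmnE !mnmE /=.
  by do !case: ifP; case: i li => [|[|[|[|i]]]] //= _; lia.
rewrite eqxx mulr1 coefD coefB coef1 coefXn coef1_XsubC1_exp.
by rewrite (ltn_eqF p1) subr0 add0r.
Qed.

(** If j >= 4, the factor u_j^(p+t) exceeds the target exponent t. If j < 4, it exhausts the
    exponent of u_j, so [mu] avoids the two inner entries involving u_j; the exponent of d then
    gives the third one degree p. Its coefficient is 1, B^p or (B - 1)^p for j = 1, 2, 3, with
    linear term 0, 0 or p up to sign. *)
Lemma dvd_coef1_sparse_coef (n p t j : nat) (mu : 'X_{1..nv n}) :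
  (1 < p)%N -> (4 <= n)%N -> (0 < j < n)%N ->
  (forall k : 'I_n,
    \sum_(i < nv n) sparse_exp (row_ix i) (col_ix i) k * mu i + (k == j :> nat) * (p + t)
    = sparse_target n p t k)%N ->
  (p%:Z %| (\prod_(i < nv n) sparse_coef (row_ix i) (col_ix i) ^+ mu i)`_1)%Z.
Proof.
move=> p1 n4 /andP[j0 jn] eqE.
have [i12 _ [r12 c12]] : exists2 i : 'I_(nv n), altXn n 1 2 = 'X_i
  & row_ix i = 1%N /\ col_ix i = 2%N by apply: altXnE; lia.
have [i13 _ [r13 c13]] : exists2 i : 'I_(nv n), altXn n 1 3 = 'X_i
  & row_ix i = 1%N /\ col_ix i = 3%N by apply: altXnE; lia.
have [i23 _ [r23 c23]] : exists2 i : 'I_(nv n), altXn n 2 3 = 'X_i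
  & row_ix i = 2%N /\ col_ix i = 3%N by apply: altXnE; lia.
have n1312 : i12 != i13 by apply/eqP => e; move: c12; rewrite e c13.
have n2312 : i23 != i12 by apply/eqP => e; move: r23; rewrite e r12.
have n2313 : i23 != i13 by apply/eqP => e; move: r23; rewrite e r13.
have deg0 : (mu i13 + (mu i12 + mu i23) = p)%N.
  have := eqE (Ordinal (ltn_trans (isT : 0 < 3)%N n4)).
  rewrite mnmE /= (ltn_eqF j0) mul0n addn0 => <-.
  rewrite (bigD1 i13) //= (bigD1 i12) //= (bigD1 i23) ?n2313 ?n2312 //=.
  rewrite big1 => [|i /andP[/andP[ne13 ne12] ne23]].
    by rewrite r12 r13 r23 c12 c13 c23 /sparse_exp /= !mul1n addn0.
  rewrite /sparse_exp; have lrc := ltn_ix i.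
  rewrite eq_ix r12 c12 in ne12; rewrite eq_ix r13 c13 in ne13.
  rewrite eq_ix r23 c23 in ne23.
  by rewrite (negbTE ne12) (negbTE ne13) (negbTE ne23) (ltn_eqF (leq_ltn_trans _ lrc)) //; case: ifP.
have := eqE (Ordinal jn); rewrite mnmE /= eqxx mul1n (gtn_eqF j0).
case: ifP => [j4|_]; last by lia.
move=> /eqP; rewrite -[X in _ == X]add0n eqn_add2r sum_nat_eq0 => /forallP E0.
(* The remaining entries have coefficient 0 or 1, and 0^0 = 1, so their product is 0 or 1. *)
have [b Qb] : exists b : bool,
    \prod_(i < nv n | (i != i13) && (i != i12)) sparse_coef (row_ix i) (col_ix i) ^+ mu i = b%:R.
  apply: (big_ind (fun q : {poly int} => exists b : bool, q = b%:R)).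
  - by exists true.
  - by move=> x y [b ->] [c ->]; exists (b && c); rewrite -natrM mulnb.
  move=> i; rewrite !eq_ix r12 c12 r13 c13 => /andP[/negbTE ne13 /negbTE ne12].
  rewrite /sparse_coef ne12 ne13.
  case: sparse_edge; first by exists true; rewrite expr1n.
  by exists (mu i == 0%N); rewrite expr0n.
rewrite (bigD1 i13) //= (bigD1 i12) //= Qb r13 c13 r12 c12 /sparse_coef /=.
have := E0 i12; have := E0 i13; have := E0 i23.
rewrite r12 r13 r23 c12 c13 c23 /sparse_exp /=.
move: j4 j0; case: (j) => [|[|[|[|?]]]] //= _ _; rewrite ?mul1n.
- move=> _ /eqP e13 /eqP e12; rewrite e13 e12 !expr0 !mul1r.
  by case: b {Qb}; rewrite ?coef1 ?coef0.
- move=> /eqP e23 _ /eqP e12; rewrite e12 expr0 mul1r.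
  have -> : mu i13 = p by lia.
  by case: b {Qb}; rewrite ?mulr0 ?coef0 // mulr1 coefXn (ltn_eqF p1).
- move=> /eqP e23 /eqP e13 _; rewrite e13 expr0 mul1r.
  have -> : mu i12 = p by lia.
  case: b {Qb}; rewrite ?mulr0 ?coef0 // mulr1 coef1_XsubC1_exp.
  by rewrite -mulr_natr dvdz_mull // natz.
Qed.

(** By additivity [c] may be taken to be one monomial. Its image is a single term, which either
    misses the target exponent or satisfies the equations of [dvd_coef1_sparse_coef]. *)
Lemma dvd_sparse_functional_firstrow (n p t j : nat) (c : Spoly n) :
  (1 < p)%N -> (4 <= n)%N -> (0 < j < n)%N ->
  (p%:Z %| sparse_functional p t (c * altXn n 0 j ^+ (p + t)))%Z.
Proof.
move=> p1 n4 jn; rewrite (mpolyE c) mulr_suml raddf_sum.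
apply: (big_ind (fun x => (p%:Z %| x)%Z)) => // [x y|mu _]; first exact: rpredD.
rewrite -[c@_mu]intz scaler_int -mulrzl -mulrA mulrzl raddfMz -mulrzr dvdz_mulr //.
rewrite /= /sparse_functional /= rmorphM rmorphXn /= sparse_spec_altXn // sparse_spec_X.
rewrite /sparse_entry exprZn mpolyXn scale_mpolyXM mcoeffZ mcoeffX.
rewrite {2}/sparse_coef /sparse_edge /= expr1n mulr1.
case: eqP => [E|_]; last by rewrite mulr0 coef0.
rewrite mulr1; apply: (@dvd_coef1_sparse_coef n p t j) => // k.
by rewrite -E mnmDE mulmnE !mnmE /sparse_exp.
Qed.

(** * Torsion and nonvanishing of the class *)

Lemma Lambda_pf_in_ideal (n p : nat) (gs : seq (Spoly n)) :
  (0 < n)%N -> ~~ odd n -> (forall g, g \in firstrow n -> g ^+ p \in gs) ->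
  in_ideal gs (Lambda p (pf n)).
Proof.
move=> n0 en sub.
rewrite (@rmorph_pf n _ (@Lambda n p) (fun a b => altXn n a b ^+ p) en); last first.
  by move=> a b; apply: Lambda_altXn.
apply: big_ind => [|x y|s ps]; [exact: in_ideal0 | exact: in_idealD |].
(* The pair at [k = 0] contains vertex 0, so its factor is the p-th power of a first-row entry. *)
have h0 : (0 < n./2)%N by lia.
rewrite (bigD1 (Ordinal h0)) //= mulrCA -mulrC; apply: in_idealM; apply: sub.
rewrite pfaff_perm_permn0 //; apply: map_f; rewrite mem_iota.
have [h1 _] := pfaff_permP _ ps.
have := h1 0%N h0; have := @permn_lt n s 1 ltac:(lia); rewrite -[0.*2]/0%N -[0.*2.+1]/1%N; lia.
Qed.

(** Leaving [rel] variable treats R and R/pR at once: the functional vanishes on multiples of [pf n]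
    and is divisible by [p] on multiples of [p]. *)
Lemma phi_pf_class_neq0 (n p : nat) (rel : seq (Spoly n)) :
  prime p -> (4 <= n)%N -> ~~ odd n -> {subset rel <= [:: pf n; p%:R]} ->
  ~ cech_top_class_zero rel (firstrow n) (phi p (pf n)) p.
Proof.
move=> pp n4 en sub [t]; have p1 := prime_gt1 pp; set r := (X in in_ideal _ X) => hr.
have dz : (p%:Z %| sparse_functional p t r)%Z.
  apply: in_ideal_raddf_dvd hr => g c /=; rewrite mem_cat => /orP[/sub|/mapP[_ /mapP[j jn ->] ->]].
    rewrite !inE => /orP[] /eqP->.
      by rewrite /sparse_functional /= rmorphM /= sparse_spec_pf // mulr0 mcoeff0 coef0.
    by rewrite mulr_natr raddfMn -mulr_natr dvdz_mull // natz.
  by apply: dvd_sparse_functional_firstrow => //; move: jn; rewrite mem_iota; lia.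
(* Multiplying by [p] replaces [phi] by [Lambda] minus a p-th power that specializes to 0;
   cancelling [p] in the integers leaves the value 1 or -1. *)
have : sparse_functional p t (p%:R * r) = (-1) ^+ p.-1 *+ p.
  rewrite -(sparse_functional_Lambda_pf t p1 n4 en) /r mulrA mulr_phi // mulrBl raddfB /=.
  rewrite [X in _ - X](_ : _ = 0) ?subr0 //.
  rewrite /sparse_functional /= rmorphM rmorphXn /= sparse_spec_pf //.
  by rewrite expr0n (gtn_eqF (prime_gt0 pp)) mul0r mcoeff0 coef0.
rewrite mulr_natl raddfMn /= => /(Num.Theory.pmulrnI (prime_gt0 pp)) e; move: dz; rewrite e.
by rewrite dvdzE abszX /= exp1n dvdn1 => /eqP p1'; rewrite p1' in p1.
Qed.

Unset Implicit Arguments.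

Theorem theorem6p2 (n p : nat) (hp : prime p) (hn : (4 <= n)%N) (hev : ~~ odd n) :
  (* p * eta = 0 in H^{n-1}_{(x_12..x_1n)}(R), R = S/(pf X) *)
  cech_top_class_zero [:: pf n] (firstrow n) (p%:R * phi p (pf n)) p /\
  (* eta <> 0 in H^{n-1}_{(x_12..x_1n)}(R) *)
  ~ cech_top_class_zero [:: pf n] (firstrow n) (phi p (pf n)) p /\
  (* image of eta in H^{n-1}_{(x_12..x_1n)}(R/pR) is nonzero *)
  ~ cech_top_class_zero [:: pf n; p%:R] (firstrow n) (phi p (pf n)) p.
Proof.
split; last by split; apply: phi_pf_class_neq0 => // g; rewrite !inE => ->.
(* The exponent t = 0 suffices: [Lambda p (pf n)] is already in the ideal of p-th powers of the
   first row, and [pf n ^+ p] is a multiple of [pf n]. *)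
exists 0%N; rewrite expr0 mulr1 addn0 mulr_phi //; apply: in_idealD.
  apply: Lambda_pf_in_ideal => //; first by lia.
  by move=> g gin; rewrite mem_cat (map_f (fun g => g ^+ p)) // orbT.
by rewrite -(prednK (prime_gt0 hp)) exprSr -mulNr; apply: in_idealM; rewrite !inE eqxx.
Qed.
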